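(* Let a graph $G=(V,E)$ be covered by graphs $G_1=(V,E_1),G_2=(V,E_2),\dots,G_k=(V,E_k)$, that is, $E=E_1\cup\dots\cup E_k$. If, for $i=1,2,\dots,k$, weighted Max-Crown on the graph $G_i$ admits an $\alpha_i$-approximation, then weighted Max-Crown on $G$ admits a $\left(\sum_{i=1}^k\alpha_i\right)$-approximation.
   Context: An instance of (weighted) Max-Crown is a graph $G=(V,E)$, a box (axis-aligned rectangle) $B_v$ of given width $w(v)>0$ and height $h(v)>0$ for each vertex $v\in V$, and a positive profit $p(e)$ for each edge $e\in E$. For a point $q$ in the plane, $B_v(q)$ denotes the placement of $B_v$ with lower left corner $q$ (no rotation). A representation of $G$ is a map $\lambda\colon V\to\mathbb{R}^2$ such that for any two vertices $u\neq v$ the placed boxes $B_u(\lambda(u))$ and $B_v(\lambda(v))$ are interior-disjoint. Two boxes are in contact if their intersection contains a line segment of positive length (touching in a single point does not count). A representation realizes an edge $(u,v)\in E$ if $B_u(\lambda(u))$ and $B_v(\lambda(v))$ are in contact. The goal is to find a representation maximizing the total profit of the realized edges; $\mathrm{OPT}$ denotes the maximum. An $\alpha$-approximation is a polynomial-time algorithm that computes a representation whose total profit of realized edges is at least $\mathrm{OPT}/\alpha$. The instances on $G_1,\dots,G_k$ use the same vertex boxes as the instance on $G$ and the same edge profits, restricted to $E_i$. The covering graphs $G_1,\dots,G_k$ are available to the algorithm for $G$. *)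

(* Defs.v *)
From mathcomp Require Import all_boot all_order all_algebra.
From mathcomp Require Import boolp classical_sets reals topology normedtype.

Set Implicit Arguments.
Unset Strict Implicit.
Unset Printing Implicit Defensive.

Import Order.TTheory GRing.Theory Num.Theory.
Import numFieldNormedType.Exports.

Local Open Scope classical_set_scope.
Local Open Scope ring_scope.

(******************************************************************************)
(* Weighted Max-Crown                                                         *)
(******************************************************************************)

Record sgraph (n : nat) := SGraph {
  adj : rel 'I_n;
  adj_sym : symmetric adj;
  adj_irr : irreflexive adj }.

Definition covered_by n k (G : sgraph n) (Gs : 'I_k -> sgraph n) : Prop :=
  forall u v, adj G u v = [exists i, adj (Gs i) u v].

(* The numbers of an instance are rational, so that instances are finite      *)
(* inputs. Only the values of [profit] on edges matter; the same [crown_data] *)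
(* therefore serves for a graph and for all its subgraphs.                    *)
Record crown_data (n : nat) := CrownData {
  width : 'I_n -> rat;
  height : 'I_n -> rat;
  profit : 'I_n -> 'I_n -> rat }.

Definition valid_data n (G : sgraph n) (D : crown_data n) : Prop :=
  (forall v, 0 < width D v /\ 0 < height D v) /\
  (forall u v, adj G u v -> profit D u v = profit D v u /\ 0 < profit D u v).

Section Geometry.
Variables (R : realType) (n : nat).
Implicit Types (D : crown_data n) (G : sgraph n) (lam : 'I_n -> R * R).

Definition box (w h : R) (q : R * R) : set (R * R) :=
  [set z | q.1 <= z.1 <= q.1 + w /\ q.2 <= z.2 <= q.2 + h].

Definition placed D lam (v : 'I_n) : set (R * R) :=
  box (ratr (width D v)) (ratr (height D v)) (lam v).

Definition representation D lam : Prop :=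
  forall u v, u != v ->
    interior (placed D lam u) `&` interior (placed D lam v) = set0.

Definition segment (a b : R * R) : set (R * R) :=
  [set z | exists t : R, 0 <= t <= 1 /\
     z = (a.1 + t * (b.1 - a.1), a.2 + t * (b.2 - a.2))].

Definition contact (A B : set (R * R)) : Prop :=
  exists a b : R * R, a <> b /\ segment a b `<=` A `&` B.

Definition total_profit G D lam : R :=
  \sum_(e : 'I_n * 'I_n | [&& (e.1 < e.2)%N, adj G e.1 e.2 &
            `[< contact (placed D lam e.1) (placed D lam e.2) >]])
     ratr (profit D e.1 e.2).

(* Only finitely many subsets of edges can be realized, so that this supremum *)
(* is a maximum.                                                              *)
Definition OPT G D : R :=
  sup [set total_profit G D lam | lam in [set lam | representation D lam]].

Definition real_layout (lam : 'I_n -> rat * rat) : 'I_n -> R * R :=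
  fun v => (ratr (lam v).1, ratr (lam v).2).

End Geometry.

(******************************************************************************)
(* Polynomial time                                                            *)
(*                                                                            *)
(* Programs of a WHILE language on binary trees with integer leaves, with     *)
(* logarithmic cost: an integer has the size of its binary expansion, and     *)
(* every primitive is charged the size of its argument and of its result.     *)
(* Each primitive runs in time polynomial in that charge on a Turing machine, *)
(* and a Turing machine step is simulated by boundedly many primitives on its *)
(* configuration, hence the functions computed within a polynomial cost are   *)
(* the polynomial-time computable ones.                                       *)
(******************************************************************************)

Inductive data := Int of int | Pair of data & data.

Fixpoint dsize (d : data) : nat :=
  match d with
  | Int z => (trunc_log 2 `|z|%N).+1
  | Pair a b => (dsize a + dsize b).+1
  end.

Inductive prim :=
  Id | Const of int | Fst | Snd | IsPair | Add | Sub | Mul | Leq.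

(* Ill-typed arguments yield [Int 0]. *)
Definition apply_prim (o : prim) (x : data) : data :=
  match o, x with
  | Id, _ => x
  | Const z, _ => Int z
  | Fst, Pair a _ => a
  | Snd, Pair _ b => b
  | IsPair, Pair _ _ => Int 1
  | Add, Pair (Int a) (Int b) => Int (a + b)
  | Sub, Pair (Int a) (Int b) => Int (a - b)
  | Mul, Pair (Int a) (Int b) => Int (a * b)
  | Leq, Pair (Int a) (Int b) => Int (if a <= b then 1 else 0)
  | _, _ => Int 0
  end.

Inductive prog :=
  | Prim of prim
  | Seq of prog & prog
  | Both of prog & prog
  | If of prog & prog & prog
  | While of prog & prog.

(* [run P x y t]: on input [x], the program [P] halts with output [y] at      *)
(* cost [t]. A test holds when its result is not [Int 0].                     *)
Inductive run : prog -> data -> data -> nat -> Prop :=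
  | RunPrim o x :
      run (Prim o) x (apply_prim o x) (dsize x + dsize (apply_prim o x))
  | RunSeq P Q x y z s t :
      run P x y s -> run Q y z t -> run (Seq P Q) x z (s + t).+1
  | RunBoth P Q x y z s t :
      run P x y s -> run Q x z t -> run (Both P Q) x (Pair y z) (s + t).+1
  | RunIfTrue C P Q x c y s t :
      run C x c s -> c <> Int 0 -> run P x y t -> run (If C P Q) x y (s + t).+1
  | RunIfFalse C P Q x y s t :
      run C x (Int 0) s -> run Q x y t -> run (If C P Q) x y (s + t).+1
  | RunWhileStop C P x s :
      run C x (Int 0) s -> run (While C P) x x s.+1
  | RunWhileStep C P x c y z s t r :
      run C x c s -> c <> Int 0 -> run P x y t -> run (While C P) y z r ->
      run (While C P) x z (s + t + r).+1.

Definition enc_seq (s : seq data) : data := foldr Pair (Int 0) s.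

Definition enc_rat (q : rat) : data := Pair (Int (numq q)) (Int (denq q)).

Definition enc_matrix n (f : 'I_n -> 'I_n -> data) : data :=
  enc_seq [seq enc_seq [seq f u v | v <- enum 'I_n] | u <- enum 'I_n].

Definition enc_graph n (G : sgraph n) : data :=
  enc_matrix (fun u v => Int (if adj G u v then 1 else 0)).

(* Profits on edges are positive, so the entry 0 encodes a non-edge. *)
Definition enc_instance n (G : sgraph n) (D : crown_data n) : data :=
  Pair (enc_seq [seq Pair (enc_rat (width D v)) (enc_rat (height D v))
                | v <- enum 'I_n])
       (enc_matrix (fun u v =>
          enc_rat (if adj G u v then profit D u v else 0))).

Definition enc_layout n (lam : 'I_n -> rat * rat) : data :=
  enc_seq [seq Pair (enc_rat (lam v).1) (enc_rat (lam v).2) | v <- enum 'I_n].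

(******************************************************************************)
(* Approximability                                                            *)
(******************************************************************************)

Definition graph_class := forall n : nat, sgraph n -> Prop.

Definition approximates (R : realType) (alpha : R) (P : prog) (q : {poly nat})
    (x : data) n (G : sgraph n) (D : crown_data n) : Prop :=
  exists (lam : 'I_n -> rat * rat) (t : nat),
    [/\ run P x (enc_layout lam) t,
        (t <= q.[dsize x])%N,
        representation D (real_layout R lam) &
        OPT R G D / alpha <= total_profit G D (real_layout R lam)].

Definition admits_approx (R : realType) (C : graph_class) (alpha : R) : Prop :=
  exists (P : prog) (q : {poly nat}),
    forall n (G : sgraph n) (D : crown_data n),
      C n G -> valid_data G D ->
      approximates alpha P q (enc_instance G D) G D.

(* Max-Crown on the graphs covered by a member of each of the classes; the    *)
(* covering graphs are part of the input.                                     *)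
Definition admits_approx_covered (R : realType) k (C : 'I_k -> graph_class)
    (alpha : R) : Prop :=
  exists (P : prog) (q : {poly nat}),
    forall n (G : sgraph n) (Gs : 'I_k -> sgraph n) (D : crown_data n),
      (forall i, C i n (Gs i)) -> covered_by G Gs -> valid_data G D ->
      approximates alpha P q
        (Pair (enc_instance G D)
              (enc_seq [seq enc_graph (Gs i) | i <- enum 'I_k])) G D.

(* Main.v *)
Require Import Defs.
From mathcomp Require Import all_boot all_order all_algebra.
From mathcomp Require Import boolp classical_sets reals.
From mathcomp Require Import zify ring lra.

(* Run the approximation algorithm of each class on the instance restricted   *)
(* to the corresponding covering graph, and return the layout of largest      *)
(* profit. If [p] is that profit, then                                        *)
(*   OPT G <= \sum_i OPT G_i <= \sum_i alpha_i * p,                           *)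
(* because a layout realizing edges of [G] realizes each of them in some      *)
(* [G_i]. Polynomial time is established for families [x, y : I -> data] of   *)
(* inputs and outputs, for which there are combinators for pairing, tests and *)
(* folds over lists. Rational sums are computed without reducing fractions:   *)
(* the product of the denominators has polynomial size.                       *)

Set Implicit Arguments.
Unset Strict Implicit.
Unset Printing Implicit Defensive.

Import Order.TTheory GRing.Theory Num.Theory.
Local Open Scope ring_scope.

(** * Programs of polynomial cost *)

(** Two inequalities carry the ratio. Every edge of [G] lies in some [G_i], so the profit of a
    layout on [G] is at most the sum of its profits on the [G_i] ([covered_profit_sum]), and the
    optima inherit this ([OPT_covered]). Conversely, since [G_i] is a subgraph of [G] and profits
    are positive, the profit on [G_i] is at most that on [G] ([covered_profit_le]). Layout [i] is
    scored on its own [G_i]; if layout [b] scores best, each optimum on [G_i] is at most [alpha_i]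
    times the profit of layout [b] on [G], and summing over [i] gives the bound.

    The rest is running time. Compositions of polynomial-cost programs stay polynomial because cost
    bounds output size ([run_dsize]). Iteration also needs a polynomial bound on all intermediate
    states ([computes_while], [computes_fold]); for sums of fractions this is [dsize_sum_rat]. By
    [contact_box], contact is a finite test on rationals, so profits can be computed
    ([computes_score]) and the best layout selected ([computes_best]). *)

Lemma leq_horner (q : {poly nat}) m n : (m <= n)%N -> (q.[m] <= q.[n])%N.
Proof.
move=> le_mn; elim/poly_ind: q => [|q c IHq]; first by rewrite !horner0.
by rewrite !hornerMXaddC leq_add2r leq_mul.
Qed.

(** Every primitive is charged its argument and its result, so a cost bound is also a bound on the
    output size. *)
Lemma run_dsize P x y t : run P x y t -> (dsize x <= t /\ dsize y <= t)%N.
Proof. by elim=> *; cbn [dsize]; lia. Qed.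

Definition pbound I (x : I -> data) (s : I -> nat) : Prop :=
  exists q : {poly nat}, forall i, (s i <= q.[dsize (x i)])%N.

(** One program and one polynomial serve the whole family. The index [i] can carry the mathematical
    objects that [x i] and [y i] encode, together with hypotheses on them, so nothing is asked of
    other inputs. *)
Definition computes I (x y : I -> data) : Prop :=
  exists P B, pbound x B /\
    forall i, exists2 t, run P (x i) (y i) t & (t <= B i)%N.

Section Bounds.
Variables (I : Type) (x : I -> data).
Implicit Types (s t : I -> nat) (y : I -> data).

Lemma pbound_size : pbound x (fun i => dsize (x i)).
Proof. by exists 'X => i; rewrite hornerX. Qed.

Lemma pbound_const c : pbound x (fun=> c).
Proof. by exists c%:P => i; rewrite hornerC. Qed.

Lemma pboundD s t : pbound x s -> pbound x t -> pbound x (fun i => s i + t i)%N.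
Proof.
by move=> [p ps] [q qt]; exists (p + q) => i; rewrite hornerD leq_add.
Qed.

Lemma pboundM s t : pbound x s -> pbound x t -> pbound x (fun i => s i * t i)%N.
Proof.
by move=> [p ps] [q qt]; exists (p * q) => i; rewrite hornerM leq_mul.
Qed.

Lemma pbound_horner (q : {poly nat}) s :
  pbound x s -> pbound x (fun i => q.[s i]).
Proof.
move=> [p ps]; exists (q \Po p) => i.
by rewrite horner_comp leq_horner.
Qed.

Lemma pbound_le s t :
  (forall i, (s i <= t i)%N) -> pbound x t -> pbound x s.
Proof. by move=> st [q qt]; exists q => i; apply: leq_trans (st i) _. Qed.

Lemma pbound_trans y s :
  pbound x (fun i => dsize (y i)) -> pbound y s -> pbound x s.
Proof. by move=> xy [q qs]; apply: pbound_le qs (pbound_horner q xy). Qed.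

Lemma computes_size y : computes x y -> pbound x (fun i => dsize (y i)).
Proof.
move=> [P [B [xB runP]]]; apply: pbound_le xB => i.
by have [t /run_dsize[_ yt] tB] := runP i; apply: leq_trans yt tB.
Qed.
End Bounds.

Lemma eq_computes I (x x' y y' : I -> data) :
  x =1 x' -> y =1 y' -> computes x y -> computes x' y'.
Proof. by move=> /funext -> /funext ->. Qed.

Lemma dsize_gt0 d : (0 < dsize d)%N. Proof. by case: d. Qed.

Lemma dsize_int_exp (a : int) : (`|a| < 2 ^ dsize (Int a))%N.
Proof. exact: trunc_log_ltn. Qed.

Lemma dsize_int_le (a : int) e :
  (0 < e)%N -> (`|a| < 2 ^ e)%N -> (dsize (Int a) <= e)%N.
Proof.
move=> e0 ae /=; have [->|a0] := posnP `|a|%N; first by rewrite trunc_log0.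
by rewrite -(ltn_exp2l _ _ (isT : 1 < 2)%N) (leq_ltn_trans _ ae) // trunc_logP.
Qed.

(** Both powers are at least 2, and then their sum is at most their product. *)
Lemma leq_exp2D m n :
  (0 < m)%N -> (0 < n)%N -> (2 ^ m + 2 ^ n <= 2 ^ (m + n))%N.
Proof.
case: m n => // m [|n] // _ _; rewrite addSn addnS !expnS expnD.
have := expn_gt0 2 m; have := expn_gt0 2 n; nia.
Qed.

(** A sum, difference or product of integers has at most as many bits as its operands together; the
    constant [e] covers the integer of [Const] and the default [Int 0]. *)
Lemma dsize_prim o :
  exists e, forall d, (dsize (apply_prim o d) <= dsize d + e)%N.
Proof.
have s0 : dsize (Int 0) = 1%N by rewrite /= trunc_log0.
have s1 : dsize (Int 1) = 1%N by rewrite /= trunc_log1.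
have two (a b z : int) :
    (`|z| < 2 ^ dsize (Int a) + 2 ^ dsize (Int b))%N ->
    (dsize (Int z) <= dsize (Pair (Int a) (Int b)) + 1)%N.
  move=> zab; apply: dsize_int_le; first by rewrite addn1.
  apply: leq_trans zab (leq_trans (leq_exp2D (dsize_gt0 _) (dsize_gt0 _)) _).
  by rewrite leq_exp2l //=; lia.
case: o => [|z|||||||].
- by exists 0%N => d; rewrite addn0.
- by exists (dsize (Int z)) => d; exact: leq_addl.
- by exists 1%N => -[a|a b]; cbn [apply_prim]; rewrite ?s0 /=; lia.
- by exists 1%N => -[a|a b]; cbn [apply_prim]; rewrite ?s0 /=; lia.
- by exists 1%N => -[a|a b]; cbn [apply_prim]; rewrite ?s0 ?s1; lia.
- exists 1%N => -[a|[a|a a'] [b|b b']]; cbn [apply_prim]; rewrite ?s0; try lia.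
  by apply: two; have := dsize_int_exp a; have := dsize_int_exp b; lia.
- exists 1%N => -[a|[a|a a'] [b|b b']]; cbn [apply_prim]; rewrite ?s0; try lia.
  by apply: two; have := dsize_int_exp a; have := dsize_int_exp b; lia.
- exists 1%N => -[a|[a|a a'] [b|b b']]; cbn [apply_prim]; rewrite ?s0; try lia.
  apply: leq_trans (leq_addr _ _); apply: dsize_int_le => //.
  rewrite abszM (leq_trans (n := 2 ^ (dsize (Int a) + dsize (Int b)))) //.
    by rewrite expnD ltn_mul ?dsize_int_exp.
  by rewrite leq_exp2l /=.
- exists 1%N => -[a|[a|a a'] [b|b b']]; cbn [apply_prim]; rewrite ?s0; try lia.
  by case: ifP => _; rewrite ?s0 ?s1; lia.
Qed.

Section Combinators.
Variables (I : Type) (x : I -> data).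
Implicit Types (y z : I -> data) (b c : I -> bool).

Lemma computes_id : computes x x.
Proof.
exists (Prim Id), (fun i => dsize (x i) + dsize (x i))%N; split.
  exact: pboundD (pbound_size x) (pbound_size x).
by move=> i; exists (dsize (x i) + dsize (x i))%N => //; exact: (RunPrim Id).
Qed.

Lemma computes_trans y z : computes x y -> computes y z -> computes x z.
Proof.
move=> xy; have xy_size := computes_size xy.
move: xy => [P [B [xB runP]]] [Q [C [yC runQ]]].
exists (Seq P Q), (fun i => B i + C i + 1)%N; split.
  exact: pboundD (pboundD xB (pbound_trans xy_size yC)) (pbound_const _ _).
move=> i; have [s rs sB] := runP i; have [t rt tC] := runQ i.
by exists (s + t).+1; [exact: RunSeq rs rt | lia].
Qed.

Lemma computes_pair y z :
  computes x y -> computes x z -> computes x (fun i => Pair (y i) (z i)).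
Proof.
move=> [P [B [xB runP]]] [Q [C [xC runQ]]].
exists (Both P Q), (fun i => B i + C i + 1)%N; split.
  exact: pboundD (pboundD xB xC) (pbound_const _ _).
move=> i; have [s rs sB] := runP i; have [t rt tC] := runQ i.
by exists (s + t).+1; [exact: RunBoth rs rt | lia].
Qed.

Lemma computes_prim o y :
  computes x y -> computes x (fun i => apply_prim o (y i)).
Proof.
move=> xy; apply: computes_trans xy _.
have [e oe] := dsize_prim o.
exists (Prim o), (fun i => dsize (y i) + (dsize (y i) + e))%N; split.
  exact: pboundD (pbound_size y) (pboundD (pbound_size y) (pbound_const _ _)).
by move=> i; eexists; [exact: RunPrim | rewrite leq_add2l].
Qed.

Lemma computes_proj y z :
  computes x (fun i => Pair (y i) (z i)) -> computes x y /\ computes x z.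
Proof.
by move=> xyz; split;
  [move/(computes_prim Fst): xyz | move/(computes_prim Snd): xyz].
Qed.

Lemma computes_int a : computes x (fun=> Int a).
Proof. exact: (computes_prim (Const a)) computes_id. Qed.

Definition decides b : Prop := computes x (fun i => Int (if b i then 1 else 0)).

Lemma computes_if b y z :
  decides b -> computes x y -> computes x z ->
  computes x (fun i => if b i then y i else z i).
Proof.
move=> [T [A [xA runT]]] [P [B [xB runP]]] [Q [C [xC runQ]]].
exists (If T P Q), (fun i => A i + (B i + C i) + 1)%N; split.
  exact: pboundD (pboundD xA (pboundD xB xC)) (pbound_const _ _).
move=> i; have [r rr rA] := runT i; have [s rs sB] := runP i.
have [t rt tC] := runQ i; case: (b i) rr => rr.
  by exists (r + s).+1; [exact: RunIfTrue rr _ rs | lia].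
by exists (r + t).+1; [exact: RunIfFalse rr rt | lia].
Qed.

Lemma decidesN b : decides b -> decides (fun i => ~~ b i).
Proof.
move=> db; have := computes_if db (computes_int 0) (computes_int 1).
by apply: eq_computes => // i; case: (b i).
Qed.

Lemma decidesI b c : decides b -> decides c -> decides (fun i => b i && c i).
Proof.
move=> db dc; have := computes_if db dc (computes_int 0).
by apply: eq_computes => // i; case: (b i).
Qed.
End Combinators.

Lemma decidesU I (x : I -> data) (b c : I -> bool) :
  decides x b -> decides x c -> decides x (fun i => b i || c i).
Proof.
move=> db dc; have := computes_if db (computes_int x 1) dc.
by apply: eq_computes => // i; case: (b i).
Qed.

(** * Loops with bounded state and folds over lists *)

Section Loops.
Variable I : Type.

(** Here [s i j] is the state after [j] of [m i] rounds. Body and test are required to work on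
    reachable states only, hence the families indexed by pairs of [i] and a round. The bound [B] on
    all states is essential: a body of polynomial cost could double the state in each round. *)
Lemma computes_while (m B : I -> nat) (s : I -> nat -> data) :
  computes (fun p : {i : I & 'I_(m i)} => s (tag p) (tagged p))
           (fun p => s (tag p) (tagged p).+1) ->
  decides (fun p : {i : I & 'I_(m i).+1} => s (tag p) (tagged p))
          (fun p => (tagged p < m (tag p))%N) ->
  pbound (s^~ 0%N) m -> pbound (s^~ 0%N) B ->
  (forall i j, (j <= m i)%N -> (dsize (s i j) <= B i)%N) ->
  computes (s^~ 0%N) (fun i => s i (m i)).
Proof.
move=> [P [A [[p pA] runP]]] [T [C [[q qC] runT]]] mb Bb sB.
exists (While T P), (fun i => (m i + 1) * (p.[B i] + q.[B i] + 1))%N; split.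
  have b1 := pbound_const (s^~ 0%N) 1%N.
  by do ![exact: pbound_horner | apply: pboundM | apply: pboundD].
move=> i.
(* Induction on the number of rounds left; every round, and the final test, costs at most [p.[B i] +
   q.[B i] + 1]. *)
have step j : (j <= m i)%N -> exists2 t, run (While T P) (s i j) (s i (m i)) t &
    (t <= (m i - j + 1) * (p.[B i] + q.[B i] + 1))%N.
  move eqr: (m i - j)%N => r; elim: r j eqr => [|r IHr] j eqr le_jm.
    have ej : j = m i by lia.
    have [t] := runT (Tagged (fun i => 'I_(m i).+1) (Ordinal (ltnSn (m i)))).
    rewrite /= ltnn => rt tC; exists t.+1; first by rewrite ej; apply: RunWhileStop.
    have := leq_trans (leq_trans tC (qC _)) (leq_horner q (sB i _ (leqnn _))).
    by rewrite /=; lia.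
  have lt_jm : (j < m i)%N by lia.
  have [u ru uB] := IHr j.+1 ltac:(lia) lt_jm.
  have [t] := runT (Tagged (fun i => 'I_(m i).+1) (Ordinal (leqW lt_jm))).
  rewrite /= lt_jm => rt tC.
  have [v rv vA] := runP (Tagged (fun i => 'I_(m i)) (Ordinal lt_jm)).
  exists (t + v + u).+1; first exact: RunWhileStep rt _ rv ru.
  have {}tC := leq_trans (leq_trans tC (qC _)) (leq_horner q (sB i _ le_jm)).
  have {}vA := leq_trans (leq_trans vA (pA _)) (leq_horner p (sB i _ le_jm)).
  move: tC vA uB; rewrite /= ; move: (p.[B i]) (q.[B i]) => a b; nia.
by have := step 0%N (leq0n _); rewrite subn0.
Qed.

(** The encodings of layouts, matrices and instances unfold to lists of this form, so the list
    lemmas apply to them by conversion. *)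
Definition fam n (h : 'I_n -> data) : seq data := [seq h v | v <- enum 'I_n].

Lemma size_fam n (h : 'I_n -> data) : size (fam h) = n.
Proof. by rewrite size_map size_enum_ord. Qed.

Lemma nth_fam n (h : 'I_n -> data) (v : 'I_n) d : nth d (fam h) v = h v.
Proof. by rewrite (nth_map v) ?size_enum_ord // nth_ord_enum. Qed.

Lemma drop_fam n (h : 'I_n -> data) (v : 'I_n) :
  drop v (fam h) = h v :: drop v.+1 (fam h).
Proof. by rewrite (drop_nth (h v)) ?size_fam // nth_fam. Qed.

Lemma take_fam n (h : 'I_n -> data) (v : 'I_n) :
  take v.+1 (fam h) = rcons (take v (fam h)) (h v).
Proof. by rewrite (take_nth (h v)) ?size_fam // nth_fam. Qed.

Lemma rev_fam n (h : 'I_n -> data) : rev (fam h) = fam (h \o @rev_ord n).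
Proof.
apply: (@eq_from_nth _ (Int 0)); rewrite size_rev !size_fam // => j lt_jn.
rewrite nth_rev ?size_fam // (nth_fam _ (Ordinal lt_jn)) /=.
by rewrite -(nth_fam h (rev_ord (Ordinal lt_jn)) (Int 0)).
Qed.

Lemma dsize_enc_seq (s : seq data) :
  dsize (enc_seq s) = (\sum_(d <- s) (dsize d).+1).+1.
Proof.
elim: s => [|d s IHs] /=; first by rewrite big_nil trunc_log0.
by rewrite IHs big_cons addnS.
Qed.

(** The terminator [Int 0], of size 1, occurs once on the left and twice on the right. *)
Lemma dsize_enc_cat s1 s2 :
  (dsize (enc_seq (s1 ++ s2))).+1 = (dsize (enc_seq s1) + dsize (enc_seq s2))%N.
Proof. by rewrite !dsize_enc_seq big_cat /= addSn addnS. Qed.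

Lemma dsize_enc_rev s : dsize (enc_seq (rev s)) = dsize (enc_seq s).
Proof.
elim: s => //= d s IHs; apply/eq_add_S.
by rewrite rev_cons -cats1 dsize_enc_cat IHs /= trunc_log0; lia.
Qed.

Lemma dsize_enc_take j s : (dsize (enc_seq (take j s)) <= dsize (enc_seq s))%N.
Proof.
have := dsize_enc_cat (take j s) (drop j s); rewrite cat_take_drop.
by have := dsize_gt0 (enc_seq (drop j s)); lia.
Qed.

Lemma dsize_enc_drop j s : (dsize (enc_seq (drop j s)) <= dsize (enc_seq s))%N.
Proof.
have := dsize_enc_cat (take j s) (drop j s); rewrite cat_take_drop.
by have := dsize_gt0 (enc_seq (take j s)); lia.
Qed.

Lemma size_le_dsize s : (size s <= dsize (enc_seq s))%N.
Proof. by elim: s => //= d s IHs; rewrite ltnS (leq_trans IHs) ?leq_addl. Qed.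

Lemma dsize_fam n (h : 'I_n -> data) (v : 'I_n) :
  (dsize (h v) <= dsize (enc_seq (fam h)))%N.
Proof.
apply: leq_trans (dsize_enc_drop v (fam h)).
by rewrite drop_fam /= leqW ?leq_addr.
Qed.

Variables (n : I -> nat) (env : I -> data).

(** The loop state holds the unread elements, a fixed environment [env i], and the accumulator
    [acc i j] after [j] elements. *)
Lemma computes_fold (h : forall i, 'I_(n i) -> data) (acc : I -> nat -> data)
    (B : I -> nat) :
  let start i := Pair (enc_seq (fam (h i))) (Pair (env i) (acc i 0%N)) in
  computes (fun p : {i : I & 'I_(n i)} =>
              Pair (h _ (tagged p)) (Pair (env (tag p)) (acc (tag p) (tagged p))))
           (fun p => acc (tag p) (tagged p).+1) ->
  pbound start B -> (forall i j, (j <= n i)%N -> (dsize (acc i j) <= B i)%N) ->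
  computes start (fun i => acc i (n i)).
Proof.
move=> start step startB accB.
pose s i j := Pair (enc_seq (drop j (fam (h i)))) (Pair (env i) (acc i j)).
have s0 : s^~ 0%N = start by apply/funext => i; rewrite /s drop0.
suff : computes start (fun i => s i (n i)).
  by move=> /computes_proj[_ /computes_proj[]].
have startn : pbound start n.
  apply: pbound_le (pbound_size start) => i.
  rewrite -[n i](size_fam (h i)) (leq_trans (size_le_dsize _)) //=; lia.
rewrite -{1}s0; apply: (@computes_while _ (fun i => dsize (start i) + B i)%N).
- apply: (@eq_computes _ (fun p : {i : I & 'I_(n i)} =>
     Pair (Pair (h _ (tagged p)) (enc_seq (drop (tagged p).+1 (fam (h (tag p))))))
          (Pair (env (tag p)) (acc (tag p) (tagged p)))) _
     (fun p => s (tag p) (tagged p).+1)) => // [[i v]|]; first by rewrite /s drop_fam.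
  have /computes_proj[/computes_proj[ch ct] ce] := computes_id
   (fun p : {i : I & 'I_(n i)} =>
     Pair (Pair (h _ (tagged p)) (enc_seq (drop (tagged p).+1 (fam (h (tag p))))))
          (Pair (env (tag p)) (acc (tag p) (tagged p)))).
  have [ce' _] := computes_proj ce.
  apply: computes_pair ct (computes_pair ce' _).
  exact: computes_trans (computes_pair ch ce) step.
(* No counter is kept: the unread list is a pair exactly as long as elements remain. *)
- have /computes_proj[/(computes_prim IsPair)+ _] := computes_id
    (fun p : {i : I & 'I_(n i).+1} => s (tag p) (tagged p)).
  apply: eq_computes => // -[i [j /= le_jn]]; case: ltnP => [lt_jn|le_nj].
    by rewrite (drop_fam _ (Ordinal lt_jn)).
  by rewrite drop_oversize // size_fam.
- by rewrite s0.
- by rewrite s0; exact: pboundD (pbound_size start) startB.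
- move=> i j le_jn; have := accB i j le_jn.
  have := dsize_enc_drop j (fam (h i)); rewrite /s /start /=; lia.
Qed.
End Loops.

(** * Lists and rational numbers *)

Section Lists.
Variables (I : Type) (n : I -> nat).
Implicit Types (h : forall i, 'I_(n i) -> data).

Lemma computes_rev h :
  computes (fun i => enc_seq (fam (h i))) (fun i => enc_seq (rev (fam (h i)))).
Proof.
set x := fun i => enc_seq (fam (h i)).
pose acc i j := enc_seq (rev (take j (fam (h i)))).
have start : computes x (fun i => Pair (x i) (Pair (Int 0) (acc i 0%N))).
  have c0 := computes_int x 0.
  apply: computes_pair (computes_id x) (computes_pair c0 _).
  by apply: eq_computes c0 => // i; rewrite /acc take0.
apply: computes_trans start _.
apply: (@eq_computes _ _ _ (fun i => acc i (n i))) => // [i|].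
  by rewrite /acc take_oversize // size_fam.
apply: (computes_fold (B := fun i => dsize (x i))).
- have /computes_proj[ch /computes_proj[_ ca]] := computes_id
    (fun p : {i : I & 'I_(n i)} =>
       Pair (h _ (tagged p)) (Pair (Int 0) (acc (tag p) (tagged p)))).
  apply: eq_computes (computes_pair ch ca) => // -[i v] /=.
  by rewrite /acc take_fam rev_rcons.
- by apply: pbound_le (pbound_size _) => i; rewrite /= leqW ?leq_addr.
- by move=> i j _; rewrite dsize_enc_rev dsize_enc_take.
Qed.

(** Folds build lists by consing, hence in reverse order; this restores the order by reversing once
    more. *)
Lemma computes_unrev (x : I -> data) h :
  computes x (fun i => enc_seq (rev (fam (h i)))) ->
  computes x (fun i => enc_seq (fam (h i))).
Proof.
move=> /computes_trans; apply.
have := computes_rev (fun i => h i \o @rev_ord (n i)).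
by apply: eq_computes => i; rewrite -rev_fam ?revK.
Qed.

(** A fold over the first list whose accumulator holds the unread part of the second list and the
    reversed output. *)
Lemma computes_zip (x : I -> data) h1 h2 :
  computes x (fun i => enc_seq (fam (h1 i))) ->
  computes x (fun i => enc_seq (fam (h2 i))) ->
  computes x (fun i => enc_seq (fam (fun v => Pair (h1 i v) (h2 i v)))).
Proof.
move=> x1 x2; apply: computes_unrev.
pose h i v := Pair (h1 i v) (h2 i v).
pose acc i j := Pair (enc_seq (drop j (fam (h2 i))))
                     (enc_seq (rev (take j (fam (h i))))).
have start : computes x
    (fun i => Pair (enc_seq (fam (h1 i))) (Pair (Int 0) (acc i 0%N))).
  have c0 := computes_int x 0.
  apply: computes_pair x1 (computes_pair c0 (computes_pair _ _)).
    by apply: eq_computes x2 => // i; rewrite drop0.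
  by apply: eq_computes c0 => // i; rewrite take0.
suff : computes x (fun i => acc i (n i)).
  move=> /computes_proj[_]; apply: eq_computes => // i.
  by rewrite take_oversize // size_fam.
apply: computes_trans start _.
have hB i : (dsize (enc_seq (fam (h i))) <=
  dsize (enc_seq (fam (h1 i))) + dsize (enc_seq (fam (h2 i))))%N.
  rewrite !dsize_enc_seq !big_map /= addSn addnS -big_split /= !ltnS.
  by apply/leqW/leq_sum => v _; rewrite addSn addnS.
apply: (computes_fold (B := fun i => 1 + dsize (enc_seq (fam (h1 i))) +
                                     2 * dsize (enc_seq (fam (h2 i))))%N).
- pose s (p : {i : I & 'I_(n i)}) := Pair (h1 _ (tagged p))
    (Pair (Int 0) (Pair (Pair (h2 _ (tagged p))
        (enc_seq (drop (tagged p).+1 (fam (h2 (tag p))))))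
      (enc_seq (rev (take (tagged p) (fam (h (tag p)))))))).
  have /computes_proj[c1 /computes_proj[_ /computes_proj[]]] := computes_id s.
  move=> /computes_proj[c2 cd] ct.
  have := computes_pair cd (computes_pair (computes_pair c1 c2) ct).
  apply: eq_computes => // -[i v]; first by rewrite /s /acc drop_fam.
  by rewrite /acc take_fam rev_rcons.
- apply: pbound_le (pboundM (pbound_const _ 2) (pbound_size _)) => i /=.
  by rewrite drop0; lia.
- move=> i j _; rewrite /acc; have := hB i.
  have := dsize_enc_take j (fam (h i)); have := dsize_enc_drop j (fam (h2 i)).
  by rewrite /= dsize_enc_rev; lia.
Qed.

(** The step is computed uniformly in [i] and the position, so one program handles all entries and
    one polynomial bounds their sizes. Nested maps arise by taking the pairs as the new index
    type. *)
Lemma computes_map (x env : I -> data) h h' :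
  computes x env -> computes x (fun i => enc_seq (fam (h i))) ->
  computes (fun p : {i : I & 'I_(n i)} => Pair (env (tag p)) (h _ (tagged p)))
           (fun p => h' _ (tagged p)) ->
  computes x (fun i => enc_seq (fam (h' i))).
Proof.
move=> xenv xh step; apply: computes_unrev.
pose acc i j := enc_seq (rev (take j (fam (h' i)))).
have start : computes x
    (fun i => Pair (enc_seq (fam (h i))) (Pair (env i) (acc i 0%N))).
  apply: computes_pair xh (computes_pair xenv _).
  by apply: eq_computes (computes_int x 0) => // i; rewrite /acc take0.
apply: (@eq_computes _ _ _ (fun i => acc i (n i))) => // [i|].
  by rewrite /acc take_oversize // size_fam.
apply: computes_trans start _.
apply: (computes_fold (B := fun i => dsize (enc_seq (fam (h' i))))).
- have /computes_proj[ch /computes_proj[ce ca]] := computes_id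
    (fun p : {i : I & 'I_(n i)} =>
      Pair (h _ (tagged p)) (Pair (env (tag p)) (acc (tag p) (tagged p)))).
  have := computes_pair (computes_trans (computes_pair ce ch) step) ca.
  apply: eq_computes => // -[i v] /=.
  by rewrite /acc take_fam rev_rcons.
(* The output has at most [dsize (y i)] entries, each of size at most [q.[dsize (y i)]]. *)
- have [q hq] := computes_size step.
  set y := fun i => _; apply: (@pbound_le _ _ _
    (fun i => dsize (y i) * (q.[dsize (y i)] + 1) + 1)%N) => [i|]; last first.
    have b1 := pbound_const y 1%N; have by_ := pbound_size y.
    by do ![exact: pbound_horner | apply: pboundM | apply: pboundD].
  rewrite dsize_enc_seq big_map -addn1 leq_add2r.
  have n_le : (n i <= dsize (y i))%N.
    by have := size_le_dsize (fam (h i)); rewrite size_fam /y /=; lia.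
  apply: leq_trans (leq_mul n_le (leqnn _)); rewrite -[X in (X * _)%N]card_ord.
  rewrite -sum_nat_const big_enum /=; apply: leq_sum => v _.
  rewrite addn1 ltnS; apply: leq_trans (hq (Tagged (fun i => 'I_(n i)) v)) _.
  by apply: leq_horner; have := dsize_fam (h i) v; rewrite /y /=; lia.
- by move=> i j _; rewrite dsize_enc_rev dsize_enc_take.
Qed.
End Lists.

(** Fractions need not be in lowest terms, so addition requires no gcd; the positive denominator
    makes comparison by cross multiplication correct. *)
Definition is_rat (d : data) : bool :=
  if d is Pair (Int _) (Int b) then 0 < b else false.

Definition rat_of (d : data) : rat :=
  if d is Pair (Int a) (Int b) then a%:~R / b%:~R else 0.

Definition mul_data d e : data := apply_prim Mul (Pair d e).
Definition num_data d : data := apply_prim Fst d.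
Definition den_data d : data := apply_prim Snd d.

Definition add_rat (d e : data) : data :=
  Pair (apply_prim Add (Pair (mul_data (num_data d) (den_data e))
                             (mul_data (num_data e) (den_data d))))
       (mul_data (den_data d) (den_data e)).

Definition le_rat (d e : data) : data :=
  apply_prim Leq (Pair (mul_data (num_data d) (den_data e))
                       (mul_data (num_data e) (den_data d))).

Lemma is_rat_enc q : is_rat (enc_rat q).
Proof. exact: denq_gt0. Qed.

Lemma rat_of_enc q : rat_of (enc_rat q) = q.
Proof. exact: divq_num_den. Qed.

Lemma is_rat_add d e : is_rat d -> is_rat e -> is_rat (add_rat d e).
Proof.
by case: d e => [//|[a|//] [b|//]] [//|[a'|//] [b'|//]] /=; exact: mulr_gt0.
Qed.

Lemma rat_of_add d e :
  is_rat d -> is_rat e -> rat_of (add_rat d e) = rat_of d + rat_of e.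
Proof.
case: d e => [//|[a|//] [b|//]] [//|[a'|//] [b'|//]] /= b0 b0'.
by rewrite addf_div ?intr_eq0 ?gt_eqF // intrD !intrM.
Qed.

Lemma le_ratE d e : is_rat d -> is_rat e ->
  le_rat d e = Int (if rat_of d <= rat_of e then 1 else 0).
Proof.
case: d e => [//|[a|//] [b|//]] [//|[a'|//] [b'|//]] /= b0 b0'.
by rewrite ler_pdivrMr ?ltr0z // mulrAC ler_pdivlMr ?ltr0z // -!intrM ler_int.
Qed.

Lemma all_fam n (a : pred data) (h : 'I_n -> data) :
  (forall v, a (h v)) -> all a (fam h).
Proof. by move=> ah; rewrite all_map; apply/allP => v _; exact: ah. Qed.

Section RatComputations.
Variables (I : Type) (x : I -> data).

Lemma computes_mul_data (y z : I -> data) :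
  computes x y -> computes x z -> computes x (fun i => mul_data (y i) (z i)).
Proof. by move=> xy xz; apply: computes_prim; apply: computes_pair. Qed.

Lemma computes_add_rat (y z : I -> data) :
  computes x y -> computes x z -> computes x (fun i => add_rat (y i) (z i)).
Proof.
move=> xy xz; have [] := (computes_prim Fst xy, computes_prim Fst xz).
have [] := (computes_prim Snd xy, computes_prim Snd xz) => y2 z2 y1 z1.
apply: computes_pair (computes_mul_data y2 z2); apply: computes_prim.
exact: computes_pair (computes_mul_data y1 z2) (computes_mul_data z1 y2).
Qed.

Lemma decides_le_rat (y z : I -> data) :
  computes x y -> computes x z ->
  (forall i, is_rat (y i)) -> (forall i, is_rat (z i)) ->
  decides x (fun i => rat_of (y i) <= rat_of (z i)).
Proof.
move=> xy xz ry rz; have [] := (computes_prim Fst xy, computes_prim Fst xz).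
have [] := (computes_prim Snd xy, computes_prim Snd xz) => y2 z2 y1 z1.
have := computes_prim Leq
  (computes_pair (computes_mul_data y1 z2) (computes_mul_data z1 y2)).
by apply: eq_computes => // i; exact: le_ratE.
Qed.

Lemma computes_enc_rat0 : computes x (fun=> enc_rat 0).
Proof. exact: computes_pair (computes_int x 0) (computes_int x 1). Qed.
End RatComputations.

Definition sum_rat (s : seq data) : data := foldl add_rat (enc_rat 0) s.

Lemma sum_ratP s : all is_rat s ->
  is_rat (sum_rat s) /\ rat_of (sum_rat s) = \sum_(d <- s) rat_of d.
Proof.
elim/last_ind: s => [|s d IHs]; first by rewrite big_nil.
rewrite all_rcons => /andP[rd /IHs[rs es]].
rewrite /sum_rat foldl_rcons -/(sum_rat s); split; first exact: is_rat_add.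
by rewrite rat_of_add // es -cats1 big_cat big_seq1.
Qed.

(** Numerator [a] and denominator [b] stay below [2 ^ dsize (enc_seq s)]. With this size called [m],
    appending [c / d] with integers of sizes [p] and [q] gives a numerator [a * d + c * b] below
    [2 ^ m * (2 ^ p + 2 ^ q)], which is at most [2 ^ (m + p + q)]. *)
Lemma dsize_sum_rat s : all is_rat s ->
  (dsize (sum_rat s) <= 2 * dsize (enc_seq s) + 3)%N.
Proof.
move=> rs; suff [a [b [-> ha hb]]] : exists a b : int,
    [/\ sum_rat s = Pair (Int a) (Int b),
        (`|a| < 2 ^ (dsize (enc_seq s)))%N & (`|b| < 2 ^ (dsize (enc_seq s)))%N].
  have /= := dsize_int_le (dsize_gt0 _) ha.
  have /= := dsize_int_le (dsize_gt0 _) hb; lia.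
elim/last_ind: s rs => [_|s d IHs].
  by exists 0, 1; rewrite /= trunc_log0.
rewrite all_rcons => /andP[+ /IHs[a [b [es sa sb]]]].
case: d => [//|[c|//] [d|//]] /= d0.
exists (a * d + c * b), (b * d).
have -> : dsize (enc_seq (rcons s (Pair (Int c) (Int d)))) =
    (dsize (enc_seq s) + dsize (Int c) + dsize (Int d) + 2)%N.
  apply/eq_add_S; rewrite -cats1 dsize_enc_cat; cbn [enc_seq foldr dsize].
  by rewrite trunc_log0; lia.
have := dsize_int_exp c; have := dsize_int_exp d.
have := leq_exp2D (dsize_gt0 (Int c)) (dsize_gt0 (Int d)).
have := dsize_gt0 (enc_seq s).
move: (dsize (enc_seq s)) (dsize (Int c)) (dsize (Int d)) sa sb => m p q.
move=> sa sb m0 pq hd hc; rewrite !expnD in pq *.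
split; first by rewrite /sum_rat foldl_rcons -/(sum_rat s) es.
- have : (`|(a * d + c * b)%R| <= `|a| * `|d| + `|c| * `|b|)%N.
    by rewrite -!abszM; lia.
  move: (2 ^ m)%N (2 ^ p)%N (2 ^ q)%N sa sb hc hd pq => M P Q; nia.
- rewrite abszM.
  move: (2 ^ m)%N (2 ^ p)%N (2 ^ q)%N sa sb hc hd pq => M P Q; nia.
Qed.

Lemma computes_sum_rat I (n : I -> nat) (x : I -> data)
    (h : forall i, 'I_(n i) -> data) :
  (forall i v, is_rat (h i v)) ->
  computes x (fun i => enc_seq (fam (h i))) ->
  computes x (fun i => sum_rat (fam (h i))).
Proof.
move=> rh xh; pose acc i j := sum_rat (take j (fam (h i))).
have start : computes x
    (fun i => Pair (enc_seq (fam (h i))) (Pair (Int 0) (acc i 0%N))).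
  apply: computes_pair xh (computes_pair (computes_int x 0) _).
  by apply: eq_computes (computes_enc_rat0 x) => // i; rewrite /acc take0.
apply: (@eq_computes _ _ _ (fun i => acc i (n i))) => // [i|].
  by rewrite /acc take_oversize // size_fam.
apply: computes_trans start _.
apply: (computes_fold (B := fun i => 2 * dsize (enc_seq (fam (h i))) + 3)%N).
- have /computes_proj[ch /computes_proj[_ ca]] := computes_id
    (fun p : {i : I & 'I_(n i)} =>
      Pair (h _ (tagged p)) (Pair (Int 0) (acc (tag p) (tagged p)))).
  apply: eq_computes (computes_add_rat ca ch) => // -[i v] /=.
  by rewrite /acc take_fam /sum_rat foldl_rcons.
- apply: pbound_le (pboundM (pbound_const _ 3) (pbound_size _)) => i /=; lia.
- move=> i j _; have := dsize_enc_take j (fam (h i)).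
  have : all is_rat (take j (fam (h i))).
    have : all is_rat (fam (h i)) by exact: all_fam.
    by rewrite -{1}(cat_take_drop j (fam (h i))) all_cat => /andP[].
  by move=> /dsize_sum_rat; rewrite /acc; lia.
Qed.

(** * Contacts and profits *)

(** For boxes of positive dimensions, the first four inequalities say that the closed boxes meet,
    and the disjunction that their intersection is not a single point. The field is a parameter
    because programs test rationals while layouts are judged over the reals. *)
Definition touch (F : realFieldType) (a b : (F * F) * (F * F)) : bool :=
  let: ((w, h), (x, y)) := a in let: ((w', h'), (x', y')) := b in
  [&& [&& x <= x' + w', x' <= x + w, y <= y' + h' & y' <= y + h] &
      ((x < x' + w') && (x' < x + w)) || ((y < y' + h') && (y' < y + h))].

Lemma touchC (F : realFieldType) (a b : (F * F) * (F * F)) :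
  touch a b = touch b a.
Proof.
move: a b => [[w h] [x y]] [[w' h'] [x' y']] /=.
by apply/idP/idP;
  move=> /andP[/and4P[-> -> -> ->] /orP[/andP[-> ->]|/andP[-> ->]]];
  rewrite ?orbT.
Qed.

Section Contact.
Variable R : realType.
Local Open Scope classical_set_scope.

Lemma segment_itv (l r t : R) :
  l <= r -> 0 <= t <= 1 -> l <= l + t * (r - l) <= r.
Proof. by move=> lr /andP[t0 t1]; apply/andP; split; nra. Qed.

(** The endpoints of a common segment lie in both boxes and differ in some coordinate, which makes
    the overlap in that direction positive. Conversely, the intersection is itself a box, and its
    diagonal is a common segment. *)
Lemma contact_box (w h w' h' : R) (q q' : R * R) :
  0 < w -> 0 < h -> 0 < w' -> 0 < h' ->
  contact (box w h q) (box w' h' q') <-> touch ((w, h), q) ((w', h'), q').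
Proof.
case: q q' => [x y] [x' y'] w0 h0 w'0 h'0; split.
  move=> [[a1 a2] [[b1 b2] [ab seg]]].
  have [] := seg (a1, a2).
    by exists 0; split; [rewrite lexx ler01 | rewrite !mul0r !addr0].
  rewrite /box /= => -[/andP[? ?] /andP[? ?]] [/andP[? ?] /andP[? ?]].
  have [] := seg (b1, b2).
    by exists 1; split; [rewrite lexx ler01 | congr pair; rewrite /=; ring].
  rewrite /box /= => -[/andP[? ?] /andP[? ?]] [/andP[? ?] /andP[? ?]].
  apply/andP; split; first by apply/and4P; split; lra.
  have [e1|n1] := eqVneq a1 b1.
    have [e2|n2] := eqVneq a2 b2; first by case: ab; rewrite e1 e2.
    apply/orP; right; apply/andP.
    by case/orP: (lt_total n2) => ?; split; lra.
  apply/orP; left; apply/andP.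
  by case/orP: (lt_total n1) => ?; split; lra.
move=> /andP[/and4P[h1 h2 h3 h4]] touching.
pose l := Num.max x x'; pose r := Num.min (x + w) (x' + w').
pose d := Num.max y y'; pose u := Num.min (y + h) (y' + h').
have lr : l <= r.
  by rewrite /l /r ge_max !le_min; do 2![apply/andP; split]; lra.
have du : d <= u.
  by rewrite /d /u ge_max !le_min; do 2![apply/andP; split]; lra.
have inter z : l <= z.1 <= r -> d <= z.2 <= u ->
    (box w h (x, y) `&` box w' h' (x', y')) z.
  rewrite /l /r /d /u !ge_max !le_min /box /=.
  by move=> /andP[/andP[-> ->] /andP[-> ->]] /andP[/andP[-> ->] /andP[-> ->]].
exists (l, d), (r, u); split.
  case=> elr edu; move: touching.
  suff : ~~ (l < r) /\ ~~ (d < u).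
    rewrite /l /r /d /u !gt_max !lt_min !ltrDl w0 w'0 h0 h'0 /= !andbT.
    by move=> [/negbTE-> /negbTE->].
  by rewrite elr edu !ltxx.
by move=> z [t [t01 ->]]; apply: inter; exact: segment_itv.
Qed.

End Contact.

(** * Total profit, its computation over the rationals, and the optimum *)

Section Profit.
Variables (R : realType) (n : nat).
Implicit Types (D : crown_data n) (G : sgraph n).
Implicit Types (lam : 'I_n -> rat * rat) (mu : 'I_n -> R * R).

Definition placement D lam (v : 'I_n) : (rat * rat) * (rat * rat) :=
  ((width D v, height D v), lam v).

Lemma contact_placed G D lam u v : valid_data G D ->
  contact (placed D (real_layout R lam) u) (placed D (real_layout R lam) v) <->
  touch (placement D lam u) (placement D lam v).
Proof.
move=> [pos _]; have [[wu hu] [wv hv]] := (pos u, pos v).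
rewrite contact_box ?ltr0q //= /placement.
case: (lam u) (lam v) => [x y] [x' y'] /=.
by rewrite -!rmorphD /= !ler_rat !ltr_rat.
Qed.

(** The inner conditional is the matrix entry that [enc_instance] encodes, so a program only has to
    add the contact test. *)
Definition gain G D lam (u v : 'I_n) : rat :=
  if touch (placement D lam u) (placement D lam v) then
    if adj G u v then profit D u v else 0
  else 0.

(* The programs sum over all ordered pairs, which avoids comparing indices    *)
(* but counts every realized edge twice.                                      *)
Lemma gain_sum G D lam : valid_data G D ->
  ratr (\sum_u \sum_v gain G D lam u v) =
  2 * total_profit G D (real_layout R lam).
Proof.
move=> vGD.
have gainC u v : gain G D lam u v = gain G D lam v u.
  rewrite /gain touchC adj_sym; case: ifP => // _; case: ifP => // Gvu.
  by case: vGD => _ /(_ v u Gvu)[].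
pose low := \sum_(e : 'I_n * 'I_n | (e.1 < e.2)%N) gain G D lam e.1 e.2.
have -> : total_profit G D (real_layout R lam) = ratr low.
  rewrite /total_profit /low rmorph_sum /= big_mkcondr /= [RHS]big_mkcond.
  rewrite [LHS]big_mkcond; apply: eq_bigr => -[u v] _ /=.
  rewrite /gain; case: (u < v)%N => //=; case: adj => /=; last first.
    by rewrite if_same rmorph0.
  have -> : `[< contact (placed D (real_layout R lam) u)
                 (placed D (real_layout R lam) v) >] =
     touch (placement D lam u) (placement D lam v).
    by apply/asboolP/idP => /(contact_placed lam u v vGD).
  by rewrite [RHS]fun_if rmorph0.
rewrite mulr_natl mulr2n -rmorphD; congr (ratr _).
rewrite pair_bigA /= (bigID (fun e : 'I_n * 'I_n => (e.1 < e.2)%N)) /=.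
congr (_ + _).
(* Among the other pairs, the diagonal gains nothing as [adj] is irreflexive, and the rest mirror
   the pairs of [low]. *)
rewrite (bigID (fun e : 'I_n * 'I_n => e.1 == e.2)) /= big1 ?add0r; last first.
  move=> [u v] /= /andP[_ /eqP->]; rewrite /gain adj_irr; exact: if_same.
rewrite /low (reindex_inj (h := fun e : 'I_n * 'I_n => (e.2, e.1))) /=; last first.
  by move=> [u v] [u' v'] [-> ->].
apply: eq_big => [[u v]|[u v] _] /=; last exact: gainC.
by rewrite -leqNgt [RHS]ltn_neqAle andbC [v == u]eq_sym.
Qed.

(** Supplies the upper bound that makes the supremum in [OPT] dominate every layout. *)
Lemma total_profit_le_all G D mu : valid_data G D ->
  total_profit G D mu <=
  \sum_(e : 'I_n * 'I_n | (e.1 < e.2)%N && adj G e.1 e.2) ratr (profit D e.1 e.2).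
Proof.
move=> [_ pos].
rewrite [leRHS](bigID (fun e => `[< contact (placed D mu e.1) (placed D mu e.2) >])).
rewrite /= /total_profit (eq_bigl _ _ (fun e => andbA _ _ _)) lerDl.
apply: sumr_ge0 => e /andP[/andP[_ Ge] _].
by rewrite ler0q ltW //; case: (pos _ _ Ge).
Qed.

Lemma OPT_ub G D mu : valid_data G D -> representation D mu ->
  total_profit G D mu <= OPT R G D.
Proof.
move=> vGD rmu; apply: ub_le_sup; last by exists mu.
eexists => _ [nu _ <-]; exact: total_profit_le_all vGD.
Qed.

(** * Profits and optima under a cover *)

Section Cover.
Variables (k : nat) (G : sgraph n) (Gs : 'I_k -> sgraph n) (D : crown_data n).
Hypotheses (cov : covered_by G Gs) (vGD : valid_data G D).

Lemma covered_adj i u v : adj (Gs i) u v -> adj G u v.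
Proof. by move=> uv; rewrite cov; apply/existsP; exists i. Qed.

Lemma covered_valid i : valid_data (Gs i) D.
Proof. by have [pos prof] := vGD; split=> // u v /covered_adj; exact: prof. Qed.

Lemma covered_profit_le i mu :
  total_profit (Gs i) D mu <= total_profit G D mu.
Proof.
rewrite /total_profit big_mkcond [leRHS]big_mkcond; apply: ler_sum => e _.
case: (e.1 < e.2)%N => //=; case Ge: (adj (Gs i)) => /=.
  by rewrite (covered_adj Ge).
case: ifP => // /andP[Ge' _]; have [_ /(_ _ _ Ge')[_ p0]] := vGD.
by rewrite ler0q ltW.
Qed.

(** An edge may lie in several [Gs i] and then be counted repeatedly, which only helps because
    profits are positive. *)
Lemma covered_profit_sum mu : 
  total_profit G D mu <= \sum_i total_profit (Gs i) D mu.
Proof.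
rewrite /total_profit; under [leRHS]eq_bigr do rewrite big_mkcond.
rewrite exchange_big big_mkcond; apply: ler_sum => e _ /=.
have pos i : 0 <= (if [&& (e.1 < e.2)%N, adj (Gs i) e.1 e.2 &
   `[< contact (placed D mu e.1) (placed D mu e.2) >]]
   then ratr (profit D e.1 e.2) else 0) :> R.
  case: ifP => // /and3P[_ /covered_adj Ge _].
  by rewrite ler0q ltW //; have [_ /(_ _ _ Ge)[]] := vGD.
case: ifP => [/and3P[e12 Ge c]|_]; last by apply: sumr_ge0 => i _; exact: pos.
move: Ge; rewrite cov => /existsP[i Gi].
rewrite (bigD1 i) //= e12 Gi c lerDl; apply: sumr_ge0 => j _.
by have := pos j; rewrite e12 c.
Qed.

Lemma OPT_covered : OPT R G D <= \sum_i OPT R (Gs i) D.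
Proof.
have [[mu0 rmu0]|norep] :=
  pselect (exists mu : 'I_n -> R * R, representation D mu).
  apply: ge_sup; first by exists (total_profit G D mu0), mu0.
  move=> _ [mu rmu <-]; apply: le_trans (covered_profit_sum mu) _.
  by apply: ler_sum => i _; apply: OPT_ub rmu; exact: covered_valid.
(* The supremum of the empty set is 0 by convention, so no representation has to be exhibited. *)
have opt0 H : OPT R H D = 0.
  have rep0 : [set mu : 'I_n -> R * R | representation D mu]%classic = set0%classic.
    by apply/seteqP; split=> // mu rmu; case: norep; exists mu.
  by rewrite /OPT rep0 image_set0 sup0.
by rewrite opt0 big1.
Qed.
End Cover.
End Profit.

(** * The algorithm *)

(** The index is fixed, so the program takes [j] tails and a head. Past the end this agrees with the
    default, since [Fst] and [Snd] send the terminator [Int 0] to itself. *)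
Lemma computes_nth I (x : I -> data) (s : I -> seq data) j :
  computes x (fun i => enc_seq (s i)) ->
  computes x (fun i => nth (Int 0) (s i) j).
Proof.
elim: j s => [|j IHj] s xs.
  by apply: eq_computes (computes_prim Fst xs) => // i; case: (s i).
have /(IHj (fun i => behead (s i))) : computes x (fun i => enc_seq (behead (s i))).
  by apply: eq_computes (computes_prim Snd xs) => // i; case: (s i).
by apply: eq_computes => // i; rewrite nth_behead.
Qed.

(** The shape that results from zipping the box dimensions of an instance with a layout. *)
Definition enc_box (a : (rat * rat) * (rat * rat)) : data :=
  Pair (Pair (enc_rat a.1.1) (enc_rat a.1.2))
       (Pair (enc_rat a.2.1) (enc_rat a.2.2)).

Lemma decides_touch I (x : I -> data) (a b : I -> (rat * rat) * (rat * rat)) :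
  computes x (fun i => enc_box (a i)) -> computes x (fun i => enc_box (b i)) ->
  decides x (fun i => touch (a i) (b i)).
Proof.
move=> /computes_proj[/computes_proj[cw ch] /computes_proj[cx cy]].
move=> /computes_proj[/computes_proj[cw' ch'] /computes_proj[cx' cy']].
have le (p q r : I -> rat) : computes x (fun i => enc_rat (p i)) ->
    computes x (fun i => enc_rat (q i)) -> computes x (fun i => enc_rat (r i)) ->
    decides x (fun i => p i <= q i + r i).
  move=> cp cq cr; have := decides_le_rat cp (computes_add_rat cq cr).
  move=> /(_ (fun=> is_rat_enc _) (fun=> is_rat_add (is_rat_enc _) (is_rat_enc _))).
  by apply: eq_computes => // i; rewrite rat_of_add ?is_rat_enc // !rat_of_enc.
have lt (p q r : I -> rat) : computes x (fun i => enc_rat (p i)) ->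
    computes x (fun i => enc_rat (q i)) -> computes x (fun i => enc_rat (r i)) ->
    decides x (fun i => p i < q i + r i).
  move=> cp cq cr; have := decides_le_rat (computes_add_rat cq cr) cp.
  move=> /(_ (fun=> is_rat_add (is_rat_enc _) (is_rat_enc _)) (fun=> is_rat_enc _)).
  move=> /decidesN; apply: eq_computes => // i.
  by rewrite rat_of_add ?is_rat_enc // !rat_of_enc -ltNge.
have : decides x (fun i =>
  [&& [&& (a i).2.1 <= (b i).2.1 + (b i).1.1, (b i).2.1 <= (a i).2.1 + (a i).1.1,
          (a i).2.2 <= (b i).2.2 + (b i).1.2 & (b i).2.2 <= (a i).2.2 + (a i).1.2] &
     ((a i).2.1 < (b i).2.1 + (b i).1.1) && ((b i).2.1 < (a i).2.1 + (a i).1.1)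
  || ((a i).2.2 < (b i).2.2 + (b i).1.2) && ((b i).2.2 < (a i).2.2 + (a i).1.2)]).
  by do ![apply: decidesI | apply: decidesU | apply: le | apply: lt].
by apply: eq_computes => // i; case: (a i) (b i) => [[? ?] [? ?]] [[? ?] [? ?]].
Qed.

Definition profit_entry n (G : sgraph n) (D : crown_data n) (u v : 'I_n) : rat :=
  if adj G u v then profit D u v else 0.

(** By [gain_sum] its value is twice the total profit; the factor is harmless in comparisons. *)
Definition score n (G : sgraph n) (D : crown_data n) lam : data :=
  sum_rat (fam (fun u => sum_rat (fam (fun v => enc_rat (gain G D lam u v))))).

Lemma scoreP n (G : sgraph n) (D : crown_data n) lam :
  is_rat (score G D lam) /\
  rat_of (score G D lam) = \sum_u \sum_v gain G D lam u v.
Proof.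
have row u : all is_rat (fam (fun v => enc_rat (gain G D lam u v))).
  by apply: all_fam => v; exact: is_rat_enc.
have [|rS ->] := @sum_ratP (fam (fun u =>
    sum_rat (fam (fun v => enc_rat (gain G D lam u v))))).
  by apply: all_fam => u; case: (sum_ratP (row u)).
split=> //; rewrite big_map big_enum /=; apply: eq_bigr => u _.
have [_ ->] := sum_ratP (row u); rewrite big_map big_enum /=.
by apply: eq_bigr => v _; exact: rat_of_enc.
Qed.

Section Instances.
Variables (I : Type) (x : I -> data) (n : I -> nat).
Variables (D : forall i, crown_data (n i)).

(** The profit matrix is zipped with the adjacency matrix of [H] and erased off the edges of [H]. On
    those edges the entry for [G] is the true profit, because [H] is a subgraph. *)
Lemma computes_restrict (G H : forall i, sgraph (n i)) :
  (forall i u v, adj (H i) u v -> adj (G i) u v) ->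
  computes x (fun i => enc_instance (G i) (D i)) ->
  computes x (fun i => enc_graph (H i)) ->
  computes x (fun i => enc_instance (H i) (D i)).
Proof.
move=> HG /computes_proj[cB cG] cH; apply: computes_pair cB _.
have cGH := computes_zip cG cH.
apply: (@computes_map _ _ _ _ _ (fun i u => enc_seq (fam (fun v =>
  enc_rat (profit_entry (H i) (D i) u v)))) (computes_int x 0) cGH).
set y := (X in computes X _).
have /computes_proj[_ /computes_proj[crG crH]] := computes_id y.
have crGH := computes_zip (n := fun p : {i : I & 'I_(n i)} => n (tag p)) crG crH.
apply: (@computes_map _ _ _ _ _ (fun p v =>
  enc_rat (profit_entry (H (tag p)) (D (tag p)) (tagged p) v))
  (computes_int y 0) crGH).
set z := (X in computes X _).
have /computes_proj[_ /computes_proj[ceG ceH]] := computes_id z.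
have := computes_if (b := fun p : {p : {i : I & 'I_(n i)} & 'I_(n (tag p))} =>
  adj (H (tag (tag p))) (tagged (tag p)) (tagged p)) ceH ceG (computes_enc_rat0 z).
apply: eq_computes => // -[[i u] v] /=; rewrite /profit_entry.
by case Huv: adj => //; rewrite (HG _ _ _ Huv).
Qed.

(** Two nested maps: the outer one carries the list of all placed boxes as environment, the inner
    one the box of [u], against which each box [v] with its matrix entry is tested. *)
Lemma computes_score (G : forall i, sgraph (n i)) lam :
  computes x (fun i => enc_instance (G i) (D i)) ->
  computes x (fun i => enc_layout (lam i)) ->
  computes x (fun i => score (G i) (D i) (lam i)).
Proof.
move=> /computes_proj[cB cG] cL.
have cP : computes x
    (fun i => enc_seq (fam (fun v => enc_box (placement (D i) (lam i) v)))).
  exact: computes_zip cB cL.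
apply: computes_sum_rat.
  move=> i u.
  by case: (@sum_ratP (fam (fun v => enc_rat (gain (G i) (D i) (lam i) u v))));
    first by apply: all_fam => v; exact: is_rat_enc.
apply: (@computes_map _ _ _ _ _ (fun i u => sum_rat (fam (fun v =>
  enc_rat (gain (G i) (D i) (lam i) u v)))) cP (computes_zip cP cG)).
set y := (X in computes X _).
have /computes_proj[cyP /computes_proj[cyu cyr]] := computes_id y.
apply: (@computes_sum_rat _ (fun p : {i : I & 'I_(n i)} => n (tag p)) _
  (fun p v => enc_rat (gain (G (tag p)) (D (tag p)) (lam (tag p)) (tagged p) v))).
  by move=> p v; exact: is_rat_enc.
have cyPr := computes_zip (n := fun p : {i : I & 'I_(n i)} => n (tag p)) cyP cyr.
apply: (@computes_map _ _ _ _ _ (fun p v =>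
  enc_rat (gain (G (tag p)) (D (tag p)) (lam (tag p)) (tagged p) v)) cyu cyPr).
set z := (X in computes X _).
have /computes_proj[czu /computes_proj[czv czr]] := computes_id z.
have := computes_if (decides_touch czu czv) czr (computes_enc_rat0 z).
by apply: eq_computes => [|p] //; rewrite /gain; case: (touch _ _).
Qed.
End Instances.

(** The candidates form a fixed list, so the program is built by induction on it, one comparison per
    candidate. The value of the current best is computed along with its layout, as the next
    comparison needs it. *)
Lemma computes_best I (x : I -> data) (T : Type) (val lay : I -> T -> data)
    (t0 : T) (s : seq T) :
  (forall i t, is_rat (val i t)) ->
  (forall t, computes x (val^~ t)) -> (forall t, computes x (lay^~ t)) ->
  exists b : I -> T,
    [/\ computes x (fun i => lay i (b i)),
        computes x (fun i => val i (b i)) &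
        forall i,
          all (fun t => rat_of (val i t) <= rat_of (val i (b i))) (t0 :: s)].
Proof.
move=> rv cv cl; elim: s => [|t s [b [clb cvb bP]]].
  by exists (fun=> t0); split=> // i; rewrite /= lexx.
have d := decides_le_rat cvb (cv t) (fun i => rv i (b i)) (fun i => rv i t).
exists (fun i => if rat_of (val i (b i)) <= rat_of (val i t) then t else b i).
split.
- apply: eq_computes (computes_if d (cl t) clb) => // i; by case: ifP.
- apply: eq_computes (computes_if d (cv t) cvb) => // i; by case: ifP.
move=> i; have /= /andP[b0 bs] := bP i.
case: ifP => [le_bt|/negbT]; last by rewrite -ltNge => /ltW->; rewrite b0.
rewrite (le_trans b0) // lexx /=; apply: sub_all bs => u /le_trans; exact.
Qed.

(** The index type for [computes] in the theorem: an input bundled with the promises made about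
    it. *)
Record covered_input k (C : 'I_k -> graph_class) := CoveredInput {
  vertices : nat;
  graph : sgraph vertices;
  cover : 'I_k -> sgraph vertices;
  boxes : crown_data vertices;
  cover_class : forall i, C i vertices (cover i);
  cover_graph : covered_by graph cover;
  boxes_valid : valid_data graph boxes }.

Theorem lemma1 (R : realType) (k : nat) (k_gt0 : (0 < k)%N)
    (C : 'I_k -> graph_class) (alpha : 'I_k -> R)
    (alpha_gt0 : forall i, 0 < alpha i) :
  (forall i, admits_approx (C i) (alpha i)) ->
  admits_approx_covered C (\sum_(i < k) alpha i).
Proof.
move=> approx.
pose x (I : covered_input C) := Pair (enc_instance (graph I) (boxes I))
  (enc_seq [seq enc_graph (cover I i) | i <- enum 'I_k]).
have /computes_proj[cG cGs] := computes_id x.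
have cover_valid i (I : covered_input C) : valid_data (cover I i) (boxes I).
  exact: covered_valid (@cover_graph _ _ I) (@boxes_valid _ _ I) i.
have cI i : computes x (fun I => enc_instance (cover I i) (boxes I)).
  apply: computes_restrict cG _ => [I u v uv|].
    exact: (covered_adj (@cover_graph _ _ I) uv).
  apply: eq_computes (computes_nth i cGs) => // I; exact: nth_fam.
have layP i :
    exists lam : forall I : covered_input C, 'I_(vertices I) -> rat * rat,
    computes x (fun I => enc_layout (lam I)) /\
    forall I, representation (boxes I) (real_layout R (lam I)) /\
      OPT R (cover I i) (boxes I) / alpha i <=
      total_profit (cover I i) (boxes I) (real_layout R (lam I)).
  have [P [q Pq]] := approx i.
  (* Choice turns the layouts output by [P] into a family indexed by inputs. *)
  have lamP (I : covered_input C) := cid (Pq _ (cover I i) (boxes I)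
    (@cover_class _ _ I i) (cover_valid i I)).
  exists (fun I => projT1 (lamP I)); split; last first.
    by move=> I; case: (lamP I) => lam /= [t [_ _ ? ?]].
  apply: computes_trans (cI i) _; exists P,
    (fun I => q.[dsize (enc_instance (cover I i) (boxes I))]).
  split; first by exists q.
  by move=> I; case: (lamP I) => lam /= [t [rt tq _ _]]; exists t.
pose lam i := projT1 (cid (layP i)).
have clam i : computes x (fun I => enc_layout (lam i I)).
  by rewrite /lam; case: cid => l [].
have lamP i I : representation (boxes I) (real_layout R (lam i I)) /\
      OPT R (cover I i) (boxes I) / alpha i <=
      total_profit (cover I i) (boxes I) (real_layout R (lam i I)).
  by rewrite /lam; case: cid => l [cl lP]; exact: lP.
(* Each layout is scored on the covering graph it was computed for, not on [G]. *)
have [b [[P [B [[q Bq] runP]]] _ bP]] :=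
  computes_best (Ordinal k_gt0) (enum 'I_k)
  (fun I i => proj1 (scoreP (cover I i) (boxes I) (lam i I)))
  (fun i => computes_score (cI i) (clam i)) clam.
exists P, q => n G Gs D CGs cov vGD.
pose I := CoveredInput CGs cov vGD.
have [t rt tB] := runP I; exists (lam (b I) I), t; split=> //.
- exact: leq_trans tB (Bq I).
- by case: (lamP (b I) I).
set prof := total_profit G D _.
(* The optimum on [Gs i] is at most [alpha i] times the profit of layout [i] on [Gs i]; this profit
   is at most that of layout [b I] on its own covering graph, hence at most [prof]. *)
have best i : OPT R (Gs i) D <= alpha i * prof.
  have [_ le_i] := lamP i I; rewrite mulrC -ler_pdivrMr //.
  apply: le_trans le_i _; apply: le_trans (covered_profit_le cov vGD (b I) _).
  (* Doubling both sides turns the profits into the values of the scores. *)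
  rewrite -(ler_pM2l (ltr0Sn R 1)) -!gain_sum; try exact: covered_valid cov vGD _.
  have /andP[_ /allP/(_ i)] := bP I; rewrite mem_enum => /(_ isT).
  by rewrite ler_rat !(proj2 (scoreP _ _ _)).
rewrite ler_pdivrMr; last first.
  rewrite (bigD1 (Ordinal k_gt0)) //= ltr_pwDl ?sumr_ge0 // => i _; exact: ltW.
rewrite mulrC mulr_suml; apply: le_trans (OPT_covered _ cov vGD) _.
exact: ler_sum.
Qed.
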